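(* Let $S$ be an admissible surface in the pseudo-isotropic space $\mathbb{I}_{\mathrm p}^3$ with local parameterization $\mathbf{x}(u^1,u^2)$, and let $\Gamma_{ij}^k$ and $h_{ij}$ be defined by $\mathbf{x}_{ij}=\Gamma_{ij}^k\mathbf{x}_k+h_{ij}\,\mathcal{N}$ with $\mathcal{N}=(0,0,1)$. Then for all $i,j,k,\ell\in\{1,2\}$ $$\Gamma_{ij,k}^{\ell}-\Gamma_{ik,j}^{\ell}+\Gamma_{ij}^s\Gamma_{ks}^{\ell}-\Gamma_{ik}^s\Gamma_{js}^{\ell}=0\quad\text{and}\quad h_{ij,k}-h_{ik,j}+\Gamma_{ij}^{\ell}h_{\ell k}-\Gamma_{ik}^{\ell}h_{\ell j}=0 .$$ In particular, the curvature tensor (and hence the intrinsic Gaussian curvature) associated with the isotropic Levi-Civita connection $\Gamma_{ij}^k$ vanishes identically for every admissible surface in $\mathbb{I}_{\mathrm p}^3$.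
   Context: The pseudo-isotropic space $\mathbb{I}_{\mathrm p}^3$ is $\mathbb{R}^3$ with the degenerate inner product $\langle \mathbf u,\mathbf v\rangle_{pz}=u^1v^1-u^2v^2$. A plane is isotropic if it contains a line parallel to the $z$-axis, and a smooth surface is admissible if none of its tangent planes is isotropic; hence $\{\mathbf{x}_1,\mathbf{x}_2,\mathcal{N}\}$ is a basis of $\mathbb{R}^3$ at each point. Here $\mathbf{x}_i=\partial\mathbf{x}/\partial u^i$, $\mathbf{x}_{ij}=\partial^2\mathbf{x}/\partial u^i\partial u^j$, a comma followed by an index $k$ denotes $\partial/\partial u^k$, and repeated indices are summed over $\{1,2\}$. *)

(* Defs.v *)
From HB Require Import structures.
From mathcomp Require Import all_boot all_order all_algebra.
From mathcomp Require Import all_classical all_reals all_analysis.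

Set Implicit Arguments.
Unset Strict Implicit.
Unset Printing Implicit Defensive.

Import Order.TTheory GRing.Theory Num.Theory.
Import numFieldNormedType.Exports.

Local Open Scope classical_set_scope.
Local Open Scope ring_scope.

(* The parameters (u^1, u^2) form a row vector u : 'rV[R]_2. The coordinate
   indices 1, 2 (and 1, 2, 3 in space) are 0, 1 : 'I_2 (and 0, 1, ord_max :
   'I_3). *)

Section Calculus.
Variables (R : realType) (V : normedModType R).
Implicit Types (U : set 'rV[R]_2) (f : 'rV[R]_2 -> V).

Definition pd (k : 'I_2) f : 'rV[R]_2 -> V := fun u => 'D_(delta_mx 0 k) f u.

Fixpoint Ck_on (n : nat) U f : Prop :=
  (forall u, U u -> {for u, continuous f}) /\
  match n with
  | 0%N => True
  | m.+1 => forall k : 'I_2,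
      (forall u, U u -> derivable f u (delta_mx 0 k)) /\ Ck_on m U (pd k f)
  end.

Definition smooth_on U f : Prop := forall n, Ck_on n U f.

End Calculus.

Section Surface.
Variable R : realType.
Implicit Types (U : set 'rV[R]_2) (x : 'rV[R]_2 -> 'rV[R]_3).

Definition pz (v w : 'rV[R]_3) : R := v 0 0 * w 0 0 - v 0 1 * w 0 1.

Definition calN : 'rV[R]_3 := delta_mx 0 ord_max.

(* The rows are the tangent vectors x_1 and x_2. *)
Definition tangent_frame x (u : 'rV[R]_2) : 'M[R]_(2, 3) :=
  \matrix_(i < 2) pd i x u.

Definition tangent_plane x (u : 'rV[R]_2) : set 'rV[R]_3 :=
  [set x u + v *m tangent_frame x u | v in [set: 'rV[R]_2]].

Definition isotropic (P : set 'rV[R]_3) : Prop :=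
  exists p, forall t : R, P (p + t *: calN).

Definition admissible_surface U x : Prop :=
  [/\ open U,
      smooth_on U x,
      forall u, U u -> row_free (tangent_frame x u)
    & forall u, U u -> ~ isotropic (tangent_plane x u)].

End Surface.

(* A connection is given by its coefficients: Gamma i j k stands for
   Gamma_{ij}^k. A tangent vector field X^i x_i is given by its row of
   components. *)
Section Connection.
Variables (R : realType) (Gamma : 'I_2 -> 'I_2 -> 'I_2 -> 'rV[R]_2 -> R).
Implicit Types X Y Z : 'rV[R]_2 -> 'rV[R]_2.

Definition nabla X Y : 'rV[R]_2 -> 'rV[R]_2 := fun u =>
  \row_l \sum_k X u 0 k *
    (pd k Y u 0 l + \sum_j Gamma k j l u * Y u 0 j).

Definition lie_bracket X Y : 'rV[R]_2 -> 'rV[R]_2 := fun u =>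
  \sum_k (X u 0 k *: pd k Y u - Y u 0 k *: pd k X u).

Definition curvature X Y Z : 'rV[R]_2 -> 'rV[R]_2 := fun u =>
  nabla X (nabla Y Z) u - nabla Y (nabla X Z) u - nabla (lie_bracket X Y) Z u.

End Connection.

Section GaussCurvature.
Variables (R : realType) (x : 'rV[R]_2 -> 'rV[R]_3).
Variable Gamma : 'I_2 -> 'I_2 -> 'I_2 -> 'rV[R]_2 -> R.

Definition first_form (u v w : 'rV[R]_2) : R :=
  pz (v *m tangent_frame x u) (w *m tangent_frame x u).

Definition first_form_det (u : 'rV[R]_2) : R :=
  let e (i : 'I_2) : 'rV[R]_2 := delta_mx 0 i in
  first_form u (e 0) (e 0) * first_form u (e 1) (e 1)
  - first_form u (e 0) (e 1) ^+ 2.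

Definition gauss_curvature (u : 'rV[R]_2) : R :=
  let e (i : 'I_2) : 'rV[R]_2 := delta_mx 0 i in
  first_form u (curvature Gamma (cst (e 0)) (cst (e 1)) (cst (e 1)) u) (e 0)
  / first_form_det u.

End GaussCurvature.

(* Main.v *)
Require Import Defs.
From HB Require Import structures.
From mathcomp Require Import all_boot all_order all_algebra.
From mathcomp Require Import all_classical all_reals all_analysis.
From mathcomp Require Import ring.

Set Implicit Arguments.
Unset Strict Implicit.
Unset Printing Implicit Defensive.

Import Order.TTheory GRing.Theory Num.Theory.
Import numFieldNormedType.Exports.

Local Open Scope classical_set_scope.
Local Open Scope ring_scope.

(** Only the third coordinate of the surface feels the vector N, so the top
view p = (x^1, x^2) satisfies p_ij = Gamma_ij^k p_k. Regularity and
admissibility make the top view a local diffeomorphism of the plane: a nonzero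
tangent vector killed by the projection would be a nonzero multiple of N and
would make the tangent plane isotropic ([admissible_top_det]). Hence Gamma is
the pull-back of the flat connection of the plane, and it has to be flat.

In coordinates, p_1, p_2 being independent, the coefficients Gamma_ij^k and
h_ij are determined by the Gauss formula through Cramer's rule
([frame_coeff]), and are therefore differentiable. Differentiating the Gauss
formula once more ([pd_gauss_formula]) writes x_kij in the frame x_1, x_2, N.
Third derivatives commute, so this expression is symmetric in j and k, and
uniqueness of the coefficients ([frame_coeff_inj]) gives both the
Gauss and the Codazzi equation ([compatibility]).

The curvature operator evaluated on arbitrary vector fields is the contraction
of the fields with the coefficients that the Gauss equation kills
([ricci_identity]), and the Gaussian curvature is obtained from it. The
determinant of the first fundamental form is minus the square of the Jacobian
of the top view ([first_form_detE]), hence nonzero.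

Equality of mixed derivatives comes from the mean value theorem: the second
difference of f over a small square is the area times either mixed derivative
at some point of the square ([mvt_square], [schwarz]). *)

(** * Symmetry of second derivatives *)

Section MixedDerivatives.
Variables (R : realType) (V : normedModType R).
Implicit Types (f : V -> R) (U : set V) (a b p u : V).

Lemma is_derive_line f p a (t : R) : derivable f (p + t *: a) a ->
  is_derive t 1 (fun s => f (p + s *: a)) ('D_a f (p + t *: a)).
Proof.
move=> fd.
have lineE : (fun h : R => h^-1 *: (((fun s => f (p + s *: a)) \o shift t)
      (h *: 1) - f (p + t *: a))) =
    (fun h : R => h^-1 *: ((f \o shift (p + t *: a)) (h *: a)
      - f (p + t *: a))).
  apply/funext => h /=; congr (_ *: (f _ - _)).
  by rewrite [h *: 1]mulr1 scalerDl addrCA.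
by split; rewrite ?/derivable ?/derive lineE.
Qed.

Lemma mvt_line f p a (r : R) : 0 < r ->
  (forall t : R, 0 <= t <= r -> derivable f (p + t *: a) a) ->
  exists2 t : R, 0 <= t <= r & f (p + r *: a) - f p = 'D_a f (p + t *: a) * r.
Proof.
move=> r0 fd.
have [||t tr] := @MVT _ (fun s => f (p + s *: a))
    (fun s => 'D_a f (p + s *: a)) 0 r r0.
- move=> t; rewrite in_itv /= => /andP[/ltW t0 /ltW tr].
  by apply: is_derive_line; apply: fd; rewrite t0 tr.
- apply: derivable_within_continuous => t; rewrite in_itv /= => tr.
  by have [] := is_derive_line (fd t tr).
move=> E; exists t; last by move: E; rewrite scale0r addr0 subr0.
by move: tr; rewrite in_itv /= => /andP[/ltW -> /ltW ->].
Qed.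

(** The mean value theorem along a, applied to the increment of f over r b,
followed by the mean value theorem along b, applied to the derivative of f
along a. *)
Lemma mvt_square f u a b (r : R) : 0 < r ->
  (forall s t : R, 0 <= s <= r -> 0 <= t <= r ->
     derivable f (u + s *: a + t *: b) a /\
     derivable ('D_a f) (u + s *: a + t *: b) b) ->
  exists s t : R, [/\ 0 <= s <= r, 0 <= t <= r &
    f (u + r *: a + r *: b) - f (u + r *: a) - f (u + r *: b) + f u =
      'D_b ('D_a f) (u + s *: a + t *: b) * (r * r)].
Proof.
move=> r0 fd.
have rr : 0 <= r <= r by rewrite ltW //=.
have r00 : (0 : R) <= 0 <= r by rewrite lexx ltW.
pose g := f \o shift (r *: b) - f.
have gd (s : R) : 0 <= s <= r -> is_derive (u + s *: a) a g
    ('D_a f (u + s *: a + r *: b) - 'D_a f (u + s *: a)).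
  move=> sr; have [d1 _] := fd s r sr rr; have [d0 _] := fd s 0 sr r00.
  move: d0; rewrite scale0r addr0 => d0.
  apply: is_deriveB; last exact: derivableP.
  have shiftE : (fun h : R => h^-1 *: ((f \o shift (r *: b) \o
        shift (u + s *: a)) (h *: a) - f (u + s *: a + r *: b))) =
      (fun h : R => h^-1 *: ((f \o shift (u + s *: a + r *: b)) (h *: a)
        - f (u + s *: a + r *: b))).
    by apply/funext => h /=; rewrite !addrA.
  by split; rewrite ?/derivable ?/derive shiftE.
have gda (s : R) : 0 <= s <= r -> derivable g (u + s *: a) a.
  by move=> sr; have [] := gd s sr.
have [s sr gE] := mvt_line r0 gda.
have fdb (t : R) : 0 <= t <= r -> derivable ('D_a f) (u + s *: a + t *: b) b.
  by move=> tr; have [] := fd s t sr tr.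
have [t tr fE] := mvt_line r0 fdb.
exists s, t; split=> //.
have [_ dg] := gd s sr.
have g_def v : g v = f (v + r *: b) - f v by [].
by rewrite mulrA -fE -dg -gE !g_def; ring.
Qed.

(** By [mvt_square] in both orders, every small parallelogram at u contains a
point p and a point q such that one mixed derivative at p equals the other at
q; continuity of both at u concludes. *)
Lemma schwarz U f u a b : open U -> U u ->
  (forall v, U v -> derivable f v a /\ derivable ('D_a f) v b) ->
  (forall v, U v -> derivable f v b /\ derivable ('D_b f) v a) ->
  {for u, continuous ('D_b ('D_a f))} -> {for u, continuous ('D_a ('D_b f))} ->
  'D_b ('D_a f) u = 'D_a ('D_b f) u.
Proof.
move=> oU Uu dab dba cab cba.
apply/eqP; rewrite -subr_eq0 -normr_le0; apply/ler_addgt0Pr => e e0.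
rewrite add0r.
have e20 : 0 < e / 2 by rewrite divr_gt0.
have close (A B q : R) : `|A - q| < e / 2 -> `|B - q| < e / 2 -> `|A - B| <= e.
  move=> /ltW Aq /ltW Bq; apply: le_trans (ler_distD q _ _) _.
  by rewrite [leRHS](splitr e) lerD // distrC.
have nab : \forall v \near u, `|'D_b ('D_a f) u - 'D_b ('D_a f) v| < e / 2.
  by move/cvgrPdist_lt : cab; apply.
have nba : \forall v \near u, `|'D_a ('D_b f) u - 'D_a ('D_b f) v| < e / 2.
  by move/cvgrPdist_lt : cba; apply.
have nU : \forall v \near u, U v by exact: open_nbhs_nbhs.
have : \forall v \near u, [/\ U v,
    `|'D_b ('D_a f) u - 'D_b ('D_a f) v| < e / 2 &
    `|'D_a ('D_b f) u - 'D_a ('D_b f) v| < e / 2].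
  by apply: filterS3 nU nab nba.
move=> /nbhs_ballP[d /= d0 du].
(* This r keeps the parallelogram on r a, r b in the ball of radius d. *)
pose r := d / (`|a| + `|b| + 1).
have n0 : 0 < `|a| + `|b| + 1 by rewrite ltr_wpDl // addr_ge0.
have r0 : 0 < r by rewrite divr_gt0.
have near_u (s t : R) : 0 <= s <= r -> 0 <= t <= r ->
    ball u d (u + s *: a + t *: b).
  move=> /andP[s0 sr] /andP[t0 tr]; rewrite -ball_normE /ball_ /=.
  rewrite -addrA opprD addNKr normrN (le_lt_trans (ler_normD _ _)) //.
  rewrite !normrZ !ger0_norm // (@le_lt_trans _ _ (r * (`|a| + `|b|))) //.
    by rewrite mulrDr lerD // ler_wpM2r.
  by rewrite /r mulrAC ltr_pdivrMr // ltr_pM2l // ltrDl.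
have near_u' (s t : R) : 0 <= s <= r -> 0 <= t <= r ->
    ball u d (u + s *: b + t *: a).
  by move=> sr tr; rewrite addrAC; exact: near_u.
have [s [t [sr tr Eab]]] :
  exists s t : R, [/\ 0 <= s <= r, 0 <= t <= r & _] :=
  mvt_square r0 (fun s t sr tr =>
    dab _ (let: And3 Uv _ _ := du _ (near_u s t sr tr) in Uv)).
have [t' [s' [tr' sr' Eba]]] :
  exists s t : R, [/\ 0 <= s <= r, 0 <= t <= r & _] :=
  mvt_square r0 (fun s t sr tr =>
    dba _ (let: And3 Uv _ _ := du _ (near_u' s t sr tr) in Uv)).
have [_ dist_ab _] := du _ (near_u _ _ sr tr).
have [_ _ dist_ba] := du _ (near_u' _ _ tr' sr').
have rr0 : r * r != 0 by rewrite mulf_neq0 // gt_eqF.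
(* Both orders evaluate the same second difference of f. *)
have E : 'D_b ('D_a f) (u + s *: a + t *: b) =
         'D_a ('D_b f) (u + t' *: b + s' *: a).
  apply: (mulIf rr0); apply: etrans (esym Eab) _; apply: etrans _ Eba.
  rewrite (addrAC u (r *: b)).
  by rewrite [in LHS](addrAC (f _)).
rewrite E in dist_ab.
exact: close dist_ab dist_ba.
Qed.

End MixedDerivatives.

(** * Partial derivatives on an open set *)

Section Coordinates.
Variable R : realType.
Implicit Types (U : set 'rV[R]_2) (u : 'rV[R]_2).

Lemma near_open U (T : Type) (f g : 'rV[R]_2 -> T) u : open U -> U u ->
  (forall v, U v -> f v = g v) -> \forall v \near u, f v = g v.
Proof.
by move=> oU Uu fg; apply: filterS fg _; exact: open_nbhs_nbhs.
Qed.

Lemma pd_eq_on (V : normedModType R) U (f g : 'rV[R]_2 -> V) k u :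
  open U -> U u -> (forall v, U v -> f v = g v) -> pd k f u = pd k g u.
Proof. by move=> oU Uu fg; apply: near_eq_derive; exact: near_open Uu fg. Qed.

Lemma derivable_eq_on (V : normedModType R) U (f g : 'rV[R]_2 -> V) u e :
  open U -> U u -> (forall v, U v -> f v = g v) ->
  derivable f u e -> derivable g u e.
Proof.
by move=> oU Uu fg; apply: near_eq_derivable; exact: near_open Uu fg.
Qed.

Lemma continuous_eq_on (V : normedModType R) U (f g : 'rV[R]_2 -> V) u :
  open U -> U u -> (forall v, U v -> f v = g v) ->
  {for u, continuous f} -> {for u, continuous g}.
Proof.
move=> oU Uu fg fc; change (g v @[v --> u] --> g u); rewrite -fg //.
apply: cvg_trans fc; apply: (@near_eq_cvg _ _ (nbhs u)).
exact: near_open Uu fg.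
Qed.

Lemma Ck_on_eq (V : normedModType R) n U (f g : 'rV[R]_2 -> V) : open U ->
  (forall v, U v -> f v = g v) -> Ck_on n U f -> Ck_on n U g.
Proof.
move=> oU; elim: n f g => [|n IHn] f g fg [fc fd]; split=> //.
- by move=> u Uu; exact: continuous_eq_on fg (fc u Uu).
- by move=> u Uu; exact: continuous_eq_on fg (fc u Uu).
- move=> k; have [fk fdk] := fd k; split.
    by move=> u Uu; apply: derivable_eq_on (fg) (fk u Uu).
  by apply: IHn fdk => v Uv; exact: pd_eq_on fg.
Qed.

Lemma pd_coord m (f : 'rV[R]_2 -> 'rV[R]_m) k u l :
  derivable f u (delta_mx 0 k) ->
  pd k f u 0 l = pd k (fun v => f v 0 l) u.
Proof. by move=> fd; rewrite /pd derive_mx // mxE. Qed.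

Lemma Ck_on_coord n U m (f : 'rV[R]_2 -> 'rV[R]_m) l : open U ->
  Ck_on n U f -> Ck_on n U (fun v => f v 0 l).
Proof.
move=> oU; elim: n f => [|n IHn] f [fc fd]; split.
- move=> u Uu; apply: (@continuous_comp _ _ _ f (fun M => M 0 l)).
    exact: fc.
  exact: coord_continuous.
- by [].
- move=> u Uu; apply: (@continuous_comp _ _ _ f (fun M => M 0 l)).
    exact: fc.
  exact: coord_continuous.
- move=> k; have [fk fdk] := fd k; split.
    by move=> u Uu; have /derivable_mxP := fk u Uu; apply.
  apply: Ck_on_eq (IHn _ fdk) => // v Uv.
  by rewrite pd_coord //; exact: fk.
Qed.

Lemma Ck_onW (V : normedModType R) n U (f : 'rV[R]_2 -> V) :
  Ck_on n.+1 U f -> Ck_on n U f.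
Proof.
elim: n f => [|n IHn] f [fc fd]; split=> // k.
by have [fk /IHn fdk] := fd k.
Qed.

Lemma Ck_on_pd (V : normedModType R) n U (f : 'rV[R]_2 -> V) k :
  Ck_on n.+1 U f -> Ck_on n U (pd k f).
Proof. by move=> [_ /(_ k) []]. Qed.

Lemma Ck_on_derivable (V : normedModType R) n U (f : 'rV[R]_2 -> V) k u :
  Ck_on n.+1 U f -> U u -> derivable f u (delta_mx 0 k).
Proof. by move=> [_ /(_ k) [+ _]]; apply. Qed.

Lemma pd_sym U (f : 'rV[R]_2 -> R) j k u : open U -> Ck_on 2 U f -> U u ->
  pd j (pd k f) u = pd k (pd j f) u.
Proof.
move=> oU f2 Uu; apply: (schwarz oU Uu).
- move=> v Uv; split; first exact: Ck_on_derivable f2 Uv.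
  exact: Ck_on_derivable (Ck_on_pd _ f2) Uv.
- move=> v Uv; split; first exact: Ck_on_derivable f2 Uv.
  exact: Ck_on_derivable (Ck_on_pd _ f2) Uv.
- by have [+ _] := Ck_on_pd j (Ck_on_pd k f2); apply.
- by have [+ _] := Ck_on_pd k (Ck_on_pd j f2); apply.
Qed.

Lemma pd_sym_row U m (f : 'rV[R]_2 -> 'rV[R]_m) j k u :
  open U -> Ck_on 2 U f -> U u -> pd j (pd k f) u = pd k (pd j f) u.
Proof.
move=> oU f2 Uu; apply/rowP => l.
have pdE i i' : pd i (pd i' f) u 0 l = pd i (pd i' (fun v => f v 0 l)) u.
  rewrite pd_coord; last exact: Ck_on_derivable (Ck_on_pd _ f2) Uu.
  apply: pd_eq_on (oU) (Uu) _ => v Uv.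
  by rewrite pd_coord //; exact: Ck_on_derivable f2 Uv.
apply: etrans (pdE j k) _; apply: etrans _ (esym (pdE k j)).
apply: (pd_sym j k oU _ Uu); exact: Ck_on_coord.
Qed.

Lemma smooth_cst (V : normedModType R) U (c : V) :
  smooth_on U (cst c : 'rV[R]_2 -> V).
Proof.
move=> n; elim: n c => [|n IHn] c; split=> //.
- by move=> u _; exact: cst_continuous.
- by move=> u _; exact: cst_continuous.
- move=> k; split; first by move=> u _; exact: derivable_cst.
  suff -> : pd k (cst c : 'rV[R]_2 -> V) = cst 0 by [].
  by apply/funext => u; exact: derive_cst.
Qed.

Lemma sum2 (M : nmodType) (F : 'I_2 -> M) : \sum_k F k = F 0 + F 1.
Proof. by rewrite big_ord_recl big_ord1; congr (_ + F _); exact: val_inj. Qed.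

Lemma pd_sum n (F : 'I_n -> 'rV[R]_2 -> R) k u :
  (forall i, derivable (F i) u (delta_mx 0 k)) ->
  pd k (fun v => \sum_i F i v) u = \sum_i pd k (F i) u.
Proof.
have -> : (fun v => \sum_i F i v) = \sum_i F i.
  by apply/funext => v; rewrite fct_sumE.
exact: derive_sum.
Qed.

Lemma derivable_sumE n (F : 'I_n -> 'rV[R]_2 -> R) e u :
  (forall i, derivable (F i) u e) -> derivable (fun v => \sum_i F i v) u e.
Proof.
have -> : (fun v => \sum_i F i v) = \sum_i F i.
  by apply/funext => v; rewrite fct_sumE.
exact: derivable_sum.
Qed.

Lemma derivable_mul (f g : 'rV[R]_2 -> R) e u :
  derivable f u e -> derivable g u e -> derivable (fun v => f v * g v) u e.
Proof. exact: derivableM. Qed.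

Lemma derivable_add (f g : 'rV[R]_2 -> R) e u :
  derivable f u e -> derivable g u e -> derivable (fun v => f v + g v) u e.
Proof. exact: derivableD. Qed.

Lemma derivable_sub (f g : 'rV[R]_2 -> R) e u :
  derivable f u e -> derivable g u e -> derivable (fun v => f v - g v) u e.
Proof. exact: derivableB. Qed.

Lemma pdM (f g : 'rV[R]_2 -> R) k u :
  derivable f u (delta_mx 0 k) -> derivable g u (delta_mx 0 k) ->
  pd k (fun v => f v * g v) u = f u * pd k g u + g u * pd k f u.
Proof. exact: deriveM. Qed.

Lemma pdD (f g : 'rV[R]_2 -> R) k u :
  derivable f u (delta_mx 0 k) -> derivable g u (delta_mx 0 k) ->
  pd k (fun v => f v + g v) u = pd k f u + pd k g u.
Proof. exact: deriveD. Qed.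

End Coordinates.

(** * The curvature operator *)

(** The Ricci identity at a point, with the values there of fields, connection
coefficients and derivatives replaced by independent scalars: dX k j stands for
pd k of the j-th component of X, d2Z k j for pd k (pd j Z) and dG k i j l for
pd k of Gamma_ij^l. First derivatives of X and Y cancel against the bracket, and
those of Z cancel between the two orders. *)
Lemma ricci_algebra (R : comPzRingType) (X Y Z : 'I_2 -> R)
    (dX dY dZ d2Z : 'I_2 -> 'I_2 -> R) (G : 'I_2 -> 'I_2 -> 'I_2 -> R)
    (dG : 'I_2 -> 'I_2 -> 'I_2 -> 'I_2 -> R) (l : 'I_2) :
  d2Z 0 1 = d2Z 1 0 ->
  let nablaZ j m := dZ j m + \sum_i G j i m * Z i in
  let dnablaZ k j := d2Z k j + \sum_i (G j i l * dZ k i + Z i * dG k j i l) in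
  let nabla2 A dB B := \sum_k A k * (\sum_j (B j * dnablaZ k j
      + nablaZ j l * dB k j) + \sum_i G k i l * \sum_j B j * nablaZ j i) in
  nabla2 X dY Y - nabla2 Y dX X
  - \sum_m (\sum_k (X k * dY k m - Y k * dX k m)) * nablaZ m l =
  \sum_k \sum_j \sum_i X k * Y j * Z i *
      (dG k j i l - dG j k i l
       + \sum_s G j i s * G k s l - \sum_s G k i s * G j s l).
Proof.
move=> sym /=; rewrite !sum2; ring: sym.
Qed.

Section Ricci.
Variables (R : realType) (Gamma : 'I_2 -> 'I_2 -> 'I_2 -> 'rV[R]_2 -> R).
Implicit Types (X Y Z : 'rV[R]_2 -> 'rV[R]_2) (u : 'rV[R]_2).

Lemma nablaE Y Z u l : nabla Gamma Y Z u 0 l =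
  \sum_j Y u 0 j * (pd j Z u 0 l + \sum_i Gamma j i l u * Z u 0 i).
Proof. by rewrite mxE. Qed.

Lemma lie_bracketE X Y u l : lie_bracket X Y u 0 l =
  \sum_k (X u 0 k * pd k Y u 0 l - Y u 0 k * pd k X u 0 l).
Proof. by rewrite summxE; apply: eq_bigr => k _; rewrite !mxE. Qed.

(* Keeps unification from unfolding derivatives down to limits of difference
quotients. *)
Opaque pd nabla lie_bracket.

Lemma pd_nabla Y Z k l u :
  (forall i j m, derivable (Gamma i j m) u (delta_mx 0 k)) ->
  derivable Y u (delta_mx 0 k) -> derivable Z u (delta_mx 0 k) ->
  (forall j, derivable (pd j Z) u (delta_mx 0 k)) ->
  pd k (nabla Gamma Y Z) u 0 l =
    \sum_j (Y u 0 j * (pd k (pd j Z) u 0 l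
       + \sum_i (Gamma j i l u * pd k Z u 0 i + Z u 0 i * pd k (Gamma j i l) u))
      + (pd j Z u 0 l + \sum_i Gamma j i l u * Z u 0 i) * pd k Y u 0 j).
Proof.
move=> Gd Yd Zd Z2d.
have coord (F : 'rV[R]_2 -> 'rV[R]_2) m : derivable F u (delta_mx 0 k) ->
  derivable (fun v => F v 0 m) u (delta_mx 0 k) by move/derivable_mxP; apply.
have GZd j m i : derivable (fun v => Gamma j i m v * Z v 0 i) u (delta_mx 0 k).
  by apply: derivable_mul; [exact: Gd | exact: coord Zd].
have inner j m :
    derivable (fun v => \sum_i Gamma j i m v * Z v 0 i) u (delta_mx 0 k).
  by apply: derivable_sumE => i; exact: GZd.
have outer j m : derivable (fun v => pd j Z v 0 m
    + \sum_i Gamma j i m v * Z v 0 i) u (delta_mx 0 k).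
  by apply: derivable_add; [exact: coord (Z2d j) | exact: inner].
have termd m j : derivable (fun v => Y v 0 j * (pd j Z v 0 m
    + \sum_i Gamma j i m v * Z v 0 i)) u (delta_mx 0 k).
  by apply: derivable_mul; [exact: coord Yd | exact: outer].
have nabla_coord m : (fun v => nabla Gamma Y Z v 0 m) = (fun v =>
    \sum_j Y v 0 j * (pd j Z v 0 m + \sum_i Gamma j i m v * Z v 0 i)).
  by apply/funext => v; rewrite nablaE.
have nabla_d : derivable (nabla Gamma Y Z) u (delta_mx 0 k).
  apply/derivable_mxP => a m; rewrite ord1 nabla_coord.
  exact: derivable_sumE (termd m).
rewrite (pd_coord _ nabla_d) nabla_coord (pd_sum (termd l)).
apply: eq_bigr => j _.
rewrite (pdM (coord _ j Yd) (outer j l)) (pdD (coord _ l (Z2d j)) (inner j l)).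
rewrite (pd_sum (GZd j l)) -(pd_coord l (Z2d j)) -(pd_coord j Yd).
congr (_ * (_ + _) + _); apply: eq_bigr => i _.
by rewrite (pdM (Gd j i l) (coord _ i Zd)) -(pd_coord i Zd).
Qed.

(** Tensoriality of the curvature: derivatives of X, Y, Z disappear because
second derivatives of Z commute. *)
Lemma ricci_identity X Y Z u l :
  (forall i j k m, derivable (Gamma i j m) u (delta_mx 0 k)) ->
  (forall k, derivable X u (delta_mx 0 k)) ->
  (forall k, derivable Y u (delta_mx 0 k)) ->
  (forall k, derivable Z u (delta_mx 0 k)) ->
  (forall j k, derivable (pd j Z) u (delta_mx 0 k)) ->
  pd 0 (pd 1 Z) u = pd 1 (pd 0 Z) u ->
  curvature Gamma X Y Z u 0 l =
    \sum_k \sum_j \sum_i X u 0 k * Y u 0 j * Z u 0 i *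
      (pd k (Gamma j i l) u - pd j (Gamma k i l) u
       + \sum_s Gamma j i s u * Gamma k s l u
       - \sum_s Gamma k i s u * Gamma j s l u).
Proof.
move=> Gd Xd Yd Zd Z2d Zsym.
have nabla2E A B : (forall k, derivable B u (delta_mx 0 k)) ->
    nabla Gamma A (nabla Gamma B Z) u 0 l = \sum_k A u 0 k * (\sum_j
      (B u 0 j * (pd k (pd j Z) u 0 l + \sum_i (Gamma j i l u * pd k Z u 0 i
        + Z u 0 i * pd k (Gamma j i l) u))
      + (pd j Z u 0 l + \sum_i Gamma j i l u * Z u 0 i) * pd k B u 0 j)
    + \sum_i Gamma k i l u * \sum_j B u 0 j * (pd j Z u 0 i
      + \sum_m Gamma j m i u * Z u 0 m)).
  move=> Bd; rewrite nablaE; apply: eq_bigr => k _.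
  rewrite (pd_nabla l (fun i j m => Gd i j k m) (Bd k) (Zd k) (Z2d^~ k)).
  by congr (_ * (_ + _)); apply: eq_bigr => i _; rewrite nablaE.
have -> : curvature Gamma X Y Z u 0 l = nabla Gamma X (nabla Gamma Y Z) u 0 l
    - nabla Gamma Y (nabla Gamma X Z) u 0 l
    - nabla Gamma (lie_bracket X Y) Z u 0 l by rewrite !mxE.
rewrite (nabla2E X Y Yd) (nabla2E Y X Xd) (nablaE (lie_bracket X Y)).
under [X in _ - X = _]eq_bigr do rewrite lie_bracketE.
move: Zsym => /(congr1 (fun w : 'rV[R]_2 => w 0 l)) Zsym.
exact: (@ricci_algebra _ (X u 0) (Y u 0) (Z u 0) (fun k j => pd k X u 0 j)
  (fun k j => pd k Y u 0 j) (fun k j => pd k Z u 0 j)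
  (fun k j => pd k (pd j Z) u 0 l)
  (fun k i m => Gamma k i m u) (fun k j i l => pd k (Gamma j i l) u) l Zsym).
Qed.

End Ricci.

(** * Coefficients in the frame x_1, x_2, N *)

Lemma ord2P (P : 'I_2 -> Prop) : P 0 -> P 1 -> forall k, P k.
Proof.
by move=> P0 P1 [[|[|//]] klt]; [move: P0 | move: P1]; congr P; exact: val_inj.
Qed.

Section Frame.
Variables (F : fieldType) (p : 'I_2 -> 'I_3 -> F).
Hypothesis p_det : p 0 0 * p 1 1 - p 0 1 * p 1 0 != 0.

(** Cramer's rule on the first two coordinates, where N vanishes; the third
coordinate then gives the coefficient of N. *)
Lemma frame_coeff (a : 'I_2 -> F) (c : F) (q : 'I_3 -> F) :
  (forall l, q l = \sum_k a k * p k l + c * (l == ord_max)%:R) ->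
  [/\ a 0 = (q 0 * p 1 1 - q 1 * p 1 0) * (p 0 0 * p 1 1 - p 0 1 * p 1 0)^-1,
      a 1 = (q 1 * p 0 0 - q 0 * p 0 1) * (p 0 0 * p 1 1 - p 0 1 * p 1 0)^-1
    & c = q ord_max - \sum_k a k * p k ord_max].
Proof.
move=> qE; split; last by rewrite qE eqxx mulr1 addrC addKr.
- by apply: (mulIf p_det); rewrite divfK // !qE !sum2 !mulr0 !addr0; ring.
- by apply: (mulIf p_det); rewrite divfK // !qE !sum2 !mulr0 !addr0; ring.
Qed.

Lemma frame_coeff_inj (a b : 'I_2 -> F) (c d : F) (q : 'I_3 -> F) :
  (forall l, q l = \sum_k a k * p k l + c * (l == ord_max)%:R) ->
  (forall l, q l = \sum_k b k * p k l + d * (l == ord_max)%:R) ->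
  (forall k, a k = b k) /\ c = d.
Proof.
move=> /frame_coeff[a0 a1 cE] /frame_coeff[b0 b1 dE].
have ab : forall k, a k = b k by apply: ord2P; rewrite ?a0 ?a1.
by split=> //; rewrite cE dE; under eq_bigr do rewrite ab.
Qed.

End Frame.

(** * Compatibility equations of the Gauss formula *)

Section GaussFormula.
Variables (R : realType) (U : set 'rV[R]_2).
Variable y : 'I_3 -> 'rV[R]_2 -> R.
Variables (Gamma : 'I_2 -> 'I_2 -> 'I_2 -> 'rV[R]_2 -> R)
          (h : 'I_2 -> 'I_2 -> 'rV[R]_2 -> R).

(** The Jacobian of the projection of the surface to the plane z = 0. *)
Definition top_det (u : 'rV[R]_2) : R :=
  pd 0 (y 0) u * pd 1 (y 1) u - pd 0 (y 1) u * pd 1 (y 0) u.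

Hypothesis oU : open U.
Hypothesis y3 : forall l, Ck_on 3 U (y l).
Hypothesis D0 : forall u, U u -> top_det u != 0.
Hypothesis gauss_formula : forall i j l u, U u ->
  pd i (pd j (y l)) u =
    \sum_k Gamma i j k u * pd k (y l) u + h i j u * (l == ord_max)%:R.

Let pd_y_C2 l k : Ck_on 2 U (pd k (y l)).
Proof. exact: Ck_on_pd. Qed.

Let pd2_y_C1 l i k : Ck_on 1 U (pd i (pd k (y l))).
Proof. exact: Ck_on_pd. Qed.

Let y_C2 l : Ck_on 2 U (y l).
Proof. exact: Ck_onW. Qed.

Lemma connection_sym i j u : U u ->
  (forall k, Gamma i j k u = Gamma j i k u) /\ h i j u = h j i u.
Proof.
move=> Uu; pose p k l := pd k (y l) u; pose q l := pd i (pd j (y l)) u.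
apply: (@frame_coeff_inj _ p (D0 Uu) _ _ _ _ q) => l; rewrite /q.
  exact: gauss_formula.
by rewrite (pd_sym i j oU (y_C2 l) Uu); exact: gauss_formula.
Qed.

Lemma derivable_top_det k u : U u -> derivable top_det u (delta_mx 0 k).
Proof.
move=> Uu; have d m l := Ck_on_derivable (k := k) (pd_y_C2 l m) Uu.
by apply: derivable_sub; apply: derivable_mul; exact: d.
Qed.

(** Near u, the coefficients are given by Cramer's rule as quotients of
differentiable functions. *)
Lemma derivable_Gamma i j l k u : U u ->
  derivable (Gamma i j l) u (delta_mx 0 k).
Proof.
move=> Uu; have d m n := Ck_on_derivable (k := k) (pd_y_C2 n m) Uu.
have d2 n := Ck_on_derivable (k := k) (pd2_y_C1 n i j) Uu.
have Dd := derivableV (D0 Uu) (derivable_top_det (k := k) Uu).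
pose p v k l := pd k (y l) v.
have cramer v (Uv : U v) := @frame_coeff _ (p v) (D0 Uv) _ _ _
  (fun l => gauss_formula i j l Uv).
move: l; apply: ord2P.
- have cramer0 v (Uv : U v) : _ = Gamma i j 0 v :=
    let: And3 E _ _ := cramer v Uv in esym E.
  apply: (derivable_eq_on oU Uu cramer0).
  exact: derivable_mul (derivable_sub (derivable_mul (d2 0) (d 1 1))
    (derivable_mul (d2 1) (d 1 0))) Dd.
- have cramer1 v (Uv : U v) : _ = Gamma i j 1 v :=
    let: And3 _ E _ := cramer v Uv in esym E.
  apply: (derivable_eq_on oU Uu cramer1).
  exact: derivable_mul (derivable_sub (derivable_mul (d2 1) (d 0 0))
    (derivable_mul (d2 0) (d 0 1))) Dd.
Qed.

Let derivable_tangential i j l k u : U u ->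
  derivable (fun v => \sum_s Gamma i j s v * pd s (y l) v) u (delta_mx 0 k).
Proof.
move=> Uu; apply: derivable_sumE => s; apply: derivable_mul.
  exact: derivable_Gamma.
exact: Ck_on_derivable (pd_y_C2 l s) Uu.
Qed.

Lemma derivable_h i j k u : U u -> derivable (h i j) u (delta_mx 0 k).
Proof.
move=> Uu.
pose p v k l := pd k (y l) v.
have hE v (Uv : U v) : _ = h i j v :=
  let: And3 _ _ E := @frame_coeff _ (p v) (D0 Uv) _ _ _
    (fun l => gauss_formula i j l Uv) in esym E.
apply: (derivable_eq_on oU Uu hE); apply: derivable_sub.
  exact: Ck_on_derivable (pd2_y_C1 ord_max i j) Uu.
exact: derivable_tangential.
Qed.

(** The second derivatives produced by the product rule are expanded again by
the Gauss formula. *)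
Lemma pd_gauss_formula i j k l u : U u ->
  pd k (pd i (pd j (y l))) u =
    \sum_m (pd k (Gamma i j m) u + \sum_s Gamma i j s u * Gamma k s m u)
      * pd m (y l) u
    + (pd k (h i j) u + \sum_s Gamma i j s u * h k s u) * (l == ord_max)%:R.
Proof.
move=> Uu.
rewrite (pd_eq_on k oU Uu (fun v Uv => gauss_formula i j l Uv)).
have Gd s := @derivable_Gamma i j s k u Uu.
have yd s := Ck_on_derivable (k := k) (pd_y_C2 l s) Uu.
have Nd : derivable (cst ((l == ord_max)%:R : R)) u (delta_mx 0 k).
  exact: derivable_cst.
have hNd := derivable_mul (@derivable_h i j k u Uu) Nd.
rewrite (pdD (@derivable_tangential i j l k u Uu) hNd).
rewrite (pdM (@derivable_h i j k u Uu) Nd).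
have -> : pd k (cst ((l == ord_max)%:R : R)) u = 0 by exact: derive_cst.
rewrite (pd_sum (fun s => derivable_mul (Gd s) (yd s))).
under eq_bigr do rewrite (pdM (Gd _) (yd _)) gauss_formula //.
rewrite /cst !sum2; ring.
Qed.

(** These are the coefficients of x_kij and of x_jik in the same frame. *)
Lemma compatibility i j k u : U u ->
  (forall l, pd k (Gamma i j l) u + \sum_s Gamma i j s u * Gamma k s l u
     = pd j (Gamma i k l) u + \sum_s Gamma i k s u * Gamma j s l u) /\
  pd k (h i j) u + \sum_s Gamma i j s u * h k s u
    = pd j (h i k) u + \sum_s Gamma i k s u * h j s u.
Proof.
move=> Uu; pose p k l := pd k (y l) u.
pose q l := pd k (pd i (pd j (y l))) u.
apply: (@frame_coeff_inj _ p (D0 Uu) _ _ _ _ q) => l; rewrite /q.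
  exact: pd_gauss_formula.
rewrite (pd_eq_on k oU Uu (fun v Uv => pd_sym i j oU (y_C2 l) Uv)).
rewrite (pd_sym k j oU (pd_y_C2 l i) Uu).
rewrite (pd_eq_on j oU Uu (fun v Uv => pd_sym k i oU (y_C2 l) Uv)).
exact: pd_gauss_formula.
Qed.

End GaussFormula.

(** * Admissible surfaces *)

Lemma det_mx2 (R : comNzRingType) (A : 'M[R]_2) :
  \det A = A 0 0 * A 1 1 - A 0 1 * A 1 0.
Proof.
rewrite (expand_det_row A 0) sum2 /cofactor !det_mx11 !mxE /= expr0 expr1.
rewrite mul1r mulN1r mulrN.
by congr (_ * A _ _ - _ * A _ _); exact: val_inj.
Qed.

Section Admissible.
Variables (R : realType) (U : set 'rV[R]_2) (x : 'rV[R]_2 -> 'rV[R]_3).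
Hypothesis xS : admissible_surface U x.

Let y l u := x u 0 l.

Lemma tangent_frameE k l u : U u -> tangent_frame x u k l = pd k (y l) u.
Proof.
case: xS => _ xs _ _ Uu; rewrite mxE pd_coord //.
exact: Ck_on_derivable (xs 1%N) Uu.
Qed.

(** If the Jacobian vanishes, some nonzero combination of x_1 and x_2 projects
to zero; it is then a nonzero multiple of N, and the tangent plane contains the
vertical line through x u. *)
Lemma admissible_top_det u : U u -> top_det y u != 0.
Proof.
case: xS => _ _ free niso Uu; apply/negP => /eqP det0.
pose A := \matrix_(i < 2, j < 2) tangent_frame x u i (widen_ord (leqnSn 2) j).
have /eqP/det0P[v v0 vA] : \det A = 0.
  rewrite det_mx2 !mxE -det0 /top_det -!tangent_frameE // !mxE.
  by congr (pd _ x u 0 _ * pd _ x u 0 _ - pd _ x u 0 _ * pd _ x u 0 _);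
    exact: val_inj.
have vT (j : 'I_2) : (v *m tangent_frame x u) 0 (widen_ord (leqnSn 2) j) = 0.
  move/matrixP: vA => /(_ 0 j); rewrite !mxE => vA.
  by rewrite -[RHS]vA; apply: eq_bigr => k _; rewrite [A k j]mxE.
pose c := (v *m tangent_frame x u) 0 ord_max.
have vTN : v *m tangent_frame x u = c *: calN R.
  apply/rowP => l; rewrite [RHS]mxE [X in _ * X]mxE eqxx /=.
  have [->|lmax] := eqVneq l ord_max; first by rewrite mulr1.
  have l2 : (l < 2)%N by rewrite ltn_neqAle -ltnS ltn_ord andbT.
  by rewrite mulr0 -(vT (Ordinal l2)); congr (_ 0 _); exact: val_inj.
have c0 : c != 0.
  apply: contra v0 => /eqP c0; move: vTN; rewrite c0 scale0r => /eqP.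
  by rewrite mulmx_free_eq0 //; exact: free.
apply: (niso u Uu); exists (x u) => t; exists ((t / c) *: v) => //.
by rewrite -scalemxAl vTN scalerA divfK.
Qed.

Lemma first_form_detE u : U u -> first_form_det x u = - top_det y u ^+ 2.
Proof.
move=> Uu.
have ffE i j : first_form x u (delta_mx 0 i) (delta_mx 0 j) =
    pd i (y 0) u * pd j (y 0) u - pd i (y 1) u * pd j (y 1) u.
  by rewrite /first_form /pz -!rowE -!tangent_frameE //; congr (_ * _ - _ * _);
    rewrite mxE.
rewrite /first_form_det !ffE /top_det.
move: (pd 0 (y 0) u) (pd 0 (y 1) u) (pd 1 (y 0) u) (pd 1 (y 1) u) => a b c d.
by ring.
Qed.

End Admissible.

(** * Flatness *)

Theorem mainTheorem5 (R : realType) (U : set 'rV[R]_2)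
    (x : 'rV[R]_2 -> 'rV[R]_3)
    (Gamma : 'I_2 -> 'I_2 -> 'I_2 -> 'rV[R]_2 -> R)
    (h : 'I_2 -> 'I_2 -> 'rV[R]_2 -> R)
    (xS : admissible_surface U x)
    (defGh : forall (i j : 'I_2) (u : 'rV[R]_2), U u ->
       pd i (pd j x) u =
         \sum_k Gamma i j k u *: pd k x u + h i j u *: calN R) :
  [/\ (* the derivatives in the two equations below exist *)
      forall (i j k l : 'I_2) (u : 'rV[R]_2), U u ->
        derivable (Gamma i j l) u (delta_mx 0 k) /\
        derivable (h i j) u (delta_mx 0 k),
      forall (i j k l : 'I_2) (u : 'rV[R]_2), U u ->
        pd k (Gamma i j l) u - pd j (Gamma i k l) u
        + \sum_s Gamma i j s u * Gamma k s l u
        - \sum_s Gamma i k s u * Gamma j s l u = 0,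
      forall (i j k : 'I_2) (u : 'rV[R]_2), U u ->
        pd k (h i j) u - pd j (h i k) u
        + \sum_l Gamma i j l u * h l k u
        - \sum_l Gamma i k l u * h l j u = 0,
      forall X Y Z : 'rV[R]_2 -> 'rV[R]_2,
        smooth_on U X -> smooth_on U Y -> smooth_on U Z ->
        forall u : 'rV[R]_2, U u -> curvature Gamma X Y Z u = 0
    & forall u : 'rV[R]_2, U u ->
        first_form_det x u != 0 /\ gauss_curvature x Gamma u = 0].
Proof.
have [oU xs _ _] := xS.
pose y (l : 'I_3) u := x u 0 l.
have y3 l : Ck_on 3 U (y l) by apply: Ck_on_coord.
have D0 u : U u -> top_det y u != 0 by exact: admissible_top_det.
have pdx k l u : U u -> pd k x u 0 l = pd k (y l) u.
  by move=> Uu; apply: pd_coord; exact: Ck_on_derivable (xs 1%N) Uu.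
have formula i j l u : U u -> pd i (pd j (y l)) u =
    \sum_k Gamma i j k u * pd k (y l) u + h i j u * (l == ord_max)%:R.
  move=> Uu; have <- := pd_eq_on i oU Uu (pdx j l).
  rewrite -pd_coord; last first.
    exact: Ck_on_derivable (Ck_on_pd j (xs 2%N)) Uu.
  rewrite defGh // mxE summxE; congr (_ + _).
    by apply: eq_bigr => k _; rewrite mxE pdx.
  by rewrite !mxE eqxx.
have sym i j u (Uu : U u) := connection_sym oU y3 D0 formula i j Uu.
have Gd i j l k u : U u -> derivable (Gamma i j l) u (delta_mx 0 k).
  by move=> Uu; exact: (derivable_Gamma oU y3 D0 formula Uu).
have hd i j k u : U u -> derivable (h i j) u (delta_mx 0 k).
  by move=> Uu; exact: (derivable_h oU y3 D0 formula Uu).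
have compat i j k u (Uu : U u) := compatibility oU y3 D0 formula i j k Uu.
have rearrange (a b s t : R) : a + s = b + t -> a - b + s - t = 0.
  by move=> ast; rewrite (addrAC a) ast; ring.
have gauss i j k l u : U u -> pd k (Gamma i j l) u - pd j (Gamma i k l) u
    + \sum_s Gamma i j s u * Gamma k s l u
    - \sum_s Gamma i k s u * Gamma j s l u = 0.
  by move=> Uu; apply: rearrange; exact: (compat i j k u Uu).1.
have curv0 X Y Z : smooth_on U X -> smooth_on U Y -> smooth_on U Z ->
    forall u, U u -> curvature Gamma X Y Z u = 0.
  move=> Xs Ys Zs u Uu; apply/rowP => l.
  have d (W : 'rV[R]_2 -> 'rV[R]_2) k :
      smooth_on U W -> derivable W u (delta_mx 0 k).
    by move=> Ws; exact: Ck_on_derivable (Ws 1%N) Uu.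
  rewrite (ricci_identity l (fun i j k m => Gd i j m k u Uu)
    (fun k => d X k Xs) (fun k => d Y k Ys) (fun k => d Z k Zs)
    (fun j k => Ck_on_derivable (Ck_on_pd j (Zs 2%N)) Uu)
    (pd_sym_row 0 1 oU (Zs 2%N) Uu)).
  rewrite mxE big1 // => k _; rewrite big1 // => j _; rewrite big1 // => i _.
  (* The Ricci identity has Gamma_ji where the Gauss equation has Gamma_ij. *)
  rewrite (pd_eq_on k oU Uu (fun v Uv => (sym j i v Uv).1 l)).
  rewrite (pd_eq_on j oU Uu (fun v Uv => (sym k i v Uv).1 l)).
  under eq_bigr do rewrite (sym j i u Uu).1.
  under [X in _ - X]eq_bigr do rewrite (sym k i u Uu).1.
  by rewrite gauss ?mulr0.
split=> //.
- by move=> i j k l u Uu; split; [exact: Gd | exact: hd].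
- move=> i j k u Uu; apply: rearrange.
  under eq_bigr do rewrite (sym _ k u Uu).2.
  under [X in _ = _ + X]eq_bigr do rewrite (sym _ j u Uu).2.
  exact: (compat i j k u Uu).2.
- move=> u Uu; split.
    by rewrite (first_form_detE xS Uu) oppr_eq0 expf_neq0 // D0.
  rewrite /gauss_curvature curv0 //; try exact: smooth_cst.
  by rewrite /first_form /pz mul0mx !mxE !mul0r subrr mul0r.
Qed.
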